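(* Let $L$ be an algebraic $m$-distributive multiplicative lattice. Then the following properties hold. (1) If $X\subseteq \mathrm{Spec}(L)$, then $S_X$ is a saturated $m$-system if and only if $\overline{X}^{\mathcal T}$ is compact with respect to the Zariski topology. (2) Let $\mathcal H(\mathrm{Spec}(L))$ be the family of all compact saturated subsets of $\mathrm{Spec}(L)$ with respect to the Zariski topology, and let $\mathcal M(L)$ be the collection of all saturated $m$-systems of $L$. Then: (a) every member of $\mathcal H(\mathrm{Spec}(L))$ is closed with respect to the topology $\mathcal T$; (b) the mappings $$\varphi\colon \mathcal H(\mathrm{Spec}(L))\to \mathcal M(L),\quad X\mapsto S_X,\qquad \psi\colon \mathcal M(L)\to \mathcal H(\mathrm{Spec}(L)),\quad S\mapsto P(S):=\bigcap_{s\in S}\mathrm{D}(s),$$ are mutually inverse inclusion-reversing bijections.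
   Context: A multiplicative lattice $(L,\vee,\cdot)$ is a complete lattice $L$ (least element $0$, largest element $1$) with a binary operation $\cdot\colon L\times L\to L$ such that $xy\leqslant x$ and $xy\leqslant y$ for all $x,y\in L$. It is $m$-distributive if $(x\vee y)z=xz\vee yz$ and $x(y\vee z)=xy\vee xz$ for all $x,y,z\in L$. $C(L)$ is the set of compact elements of $L$ (those $c$ such that $c\leqslant\bigvee X$ implies $c\leqslant\bigvee X_0$ for some finite $X_0\subseteq X$); $L$ is algebraic if every element is the join of a subset of $C(L)$. An element $p\neq 1$ of $L$ is prime if, for all $x,y\in L$, $xy\leqslant p$ implies $x\leqslant p$ or $y\leqslant p$. $\mathrm{Spec}(L)$ is the set of prime elements, with the Zariski topology, whose closed sets are the sets $\mathrm{V}(x):=\{p\in\mathrm{Spec}(L)\mid x\leqslant p\}$, $x\in L$; put $\mathrm{D}(x):=\mathrm{Spec}(L)\setminus\mathrm{V}(x)$. Compact means that every open cover has a finite subcover (no Hausdorff assumption). A subset of $\mathrm{Spec}(L)$ is saturated if it is an intersection of Zariski open sets. $\mathcal T$ is the topology on $\mathrm{Spec}(L)$ having as a basis of open sets the sets $\mathrm{V}(c)$, $c\in C(L)$; $\overline{X}^{\mathcal T}$ denotes the closure of $X\subseteq\mathrm{Spec}(L)$ with respect to $\mathcal T$. An $m$-system in $L$ is a nonempty subset $S$ of $C(L)$ such that for all $x,y\in S$ there exists $z\in S$ with $z\leqslant xy$. It is saturated if $x\in S$, $c\in C(L)$ and $x\leqslant c$ imply $c\in S$. For $Y\subseteq\mathrm{Spec}(L)$,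 $S_Y:=\{c\in C(L)\mid c\not\leqslant p\text{ for all }p\in Y\}$. *)

(* Defs.v *)
From HB Require Import structures.
From mathcomp Require Import all_boot all_order.
From mathcomp Require Import boolp classical_sets functions cardinality.
From mathcomp Require Import topology.

Set Implicit Arguments.
Unset Strict Implicit.
Unset Printing Implicit Defensive.

Import Order.TTheory.

Local Open Scope classical_set_scope.
Local Open Scope order_scope.

HB.mixin Record isCompleteLattice d L & Order.TBLattice d L := {
  bigjoin : set L -> L;
  bigjoinP : forall A : set L, supremums A (bigjoin A)
}.

#[short(type="completeLatticeType")]
HB.structure Definition CompleteLattice d :=
  { L of Order.TBLattice d L & isCompleteLattice d L }.

(* The multiplication is not assumed to be associative, commutative, monotone
   or unital. *)
HB.mixin Record isMultLattice d L & CompleteLattice d L := {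
  mul : L -> L -> L;
  mul_lel : forall x y : L, mul x y <= x;
  mul_ler : forall x y : L, mul x y <= y
}.

#[short(type="multLatticeType")]
HB.structure Definition MultLattice d :=
  { L of CompleteLattice d L & isMultLattice d L }.

Section CompactElements.
Context d (L : completeLatticeType d).

Definition compact_elt : set L :=
  [set c | forall X : set L, c <= bigjoin X ->
    exists X0 : set L, [/\ finite_set X0, X0 `<=` X & c <= bigjoin X0]].

Definition algebraic : Prop :=
  forall x : L, exists2 X : set L, X `<=` compact_elt & x = bigjoin X.

Lemma bigjoin_ub (A : set L) x : A x -> x <= bigjoin A.
Proof. by move: x; have [] := bigjoinP A. Qed.

Lemma bigjoin_least (A : set L) y :
  (forall x, A x -> x <= y) -> bigjoin A <= y.
Proof. by have [_] := bigjoinP A; apply. Qed.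

Lemma compact_elt0 : compact_elt \bot.
Proof. by move=> X _; exists set0; split=> //; rewrite le0x. Qed.

Lemma compact_eltU a b : compact_elt a -> compact_elt b ->
  compact_elt (a `|` b).
Proof.
move=> ca cb X; rewrite leUx => /andP[/ca[A [fA AX aA]] /cb[B [fB BX bB]]].
exists (A `|` B)%classic; split.
- by rewrite finite_setU.
- by move=> x [/AX|/BX].
- rewrite leUx; apply/andP; split.
    by apply: le_trans aA _; apply: bigjoin_least => x Ax; apply: bigjoin_ub; left.
  by apply: le_trans bB _; apply: bigjoin_least => x Bx; apply: bigjoin_ub; right.
Qed.

End CompactElements.
Arguments compact_elt {d L}.
Arguments algebraic {d} L.

Section Spectrum.
Context d (L : multLatticeType d).

Definition m_distributive : Prop :=
  (forall x y z : L, mul (x `|` y) z = mul x z `|` mul y z) /\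
  (forall x y z : L, mul x (y `|` z) = mul x y `|` mul x z).

Definition prime_elt : set L :=
  [set p | p <> \top /\ forall x y : L, mul x y <= p -> x <= p \/ y <= p].

Definition Spec : Type := set_type prime_elt.

HB.instance Definition _ := Choice.on Spec.

Definition V (x : L) : set Spec := [set p | x <= \val p].

Definition D (x : L) : set Spec := ~` V x.

Definition zariski_open : set (set Spec) := [set D x | x in [set: L]].

Lemma zariski_openT : zariski_open setT.
Proof.
exists \top => //.
apply/seteqP; split=> // p _; rewrite /D /V /= le1x => /eqP.
by have /set_mem[] := valP p.
Qed.

Lemma zariski_openI : setI_closed zariski_open.
Proof.
move=> _ _ [x _ <-] [y _ <-]; exists (mul x y) => //.
rewrite /D -setCU; congr (~` _); apply/seteqP; split=> p /=; rewrite /V /=.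
  by have /set_mem[_] := valP p; apply.
by case=> /(le_trans _); apply; [exact: mul_lel|exact: mul_ler].
Qed.

Lemma zariski_open_bigcup (I : Type) (f : I -> set Spec) :
  (forall i, zariski_open (f i)) -> zariski_open (\bigcup_i f i).
Proof.
move=> fo; exists (bigjoin [set x | exists i, D x = f i]) => //.
apply/seteqP; split=> p.
  apply: contra_notP => pf; apply: bigjoin_least => x [i xi].
  by apply: contra_notP pf => px; exists i => //; rewrite -xi.
move=> [i _]; have [x _ xi] := fo i; rewrite -xi => px /= bp.
by apply: px; apply: le_trans bp; apply: bigjoin_ub; exists i.
Qed.

HB.instance Definition _ := isOpenTopological.Build Spec
  zariski_openT zariski_openI zariski_open_bigcup.

(* A copy of [Spec] that carries the topology with basis the sets [V c], c
   compact, whereas [Spec] itself carries the Zariski topology. *)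
Definition SpecT : Type := Spec.

HB.instance Definition _ := Choice.on SpecT.

Definition V_basis : set (set SpecT) := [set V c | c in compact_elt].

Lemma V_basis_cover : \bigcup_(B in V_basis) id B = setT.
Proof.
apply/seteqP; split=> // p _; exists (V \bot); last by rewrite /V /= le0x.
by exists \bot => //; exact: compact_elt0.
Qed.

Lemma V_basis_join (A B : set SpecT) p : V_basis A -> V_basis B ->
  id A p -> id B p -> exists C, [/\ V_basis C, id C p & id C `<=` id A `&` id B].
Proof.
move=> [a ca <-] [b cb <-] /= pa pb; exists (V (a `|` b)); split.
- by exists (a `|` b) => //; exact: compact_eltU.
- by rewrite /V /= leUx; apply/andP.
- by move=> q; rewrite /V /= leUx => /andP.
Qed.

HB.instance Definition _ := isBaseTopological.Build SpecT
  V_basis_cover V_basis_join.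

Definition T_closure (X : set Spec) : set Spec := closure (X : set SpecT).

Definition T_closed (X : set Spec) : Prop := closed (X : set SpecT).

Definition saturated_set (X : set Spec) : Prop :=
  exists2 F : set (set Spec), F `<=` open & X = \bigcap_(U in F) U.

Definition compact_saturated : set (set Spec) :=
  [set X | cover_compact X /\ saturated_set X].

Definition m_system (S : set L) : Prop :=
  [/\ S !=set0, S `<=` compact_elt &
      forall x y, S x -> S y -> exists2 z, S z & z <= mul x y].

Definition saturated_m_system : set (set L) :=
  [set S | m_system S /\
    forall x c, S x -> compact_elt c -> x <= c -> S c].

Definition S_ (Y : set Spec) : set L :=
  [set c | compact_elt c /\ forall p, Y p -> ~ (c <= \val p)].

Definition P_ (S : set L) : set Spec := \bigcap_(s in S) D s.

End Spectrum.
Arguments m_distributive {d} L.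
Arguments Spec {d} L.
Arguments SpecT {d} L.
Arguments compact_saturated {d} L.
Arguments saturated_m_system {d} L.
Arguments S_ {d L} Y.
Arguments P_ {d L} S.

(* Main.v *)
(** Zorn's lemma, applied to the elements above [x] that lie above no member of
    an m-system [S], yields a prime; hence [P_ S] is covered by [D x] exactly
    when some [s] in [S] lies below [x]. As the members of [S] are compact
    elements, this makes [P_ S] Zariski compact and gives [S_ (P_ S) = S] for
    saturated [S]. Conversely, when a Zariski compact [X] is contained in [D x],
    algebraicity gives a compact [c <= x] with [X] contained in [D c]: this makes
    [S_ X] an m-system and, for saturated [X], makes [X] closed for the topology
    [T]. The two directions meet through the identity
    [T_closure X = P_ (S_ X)]. *)

Require Import Defs.
From mathcomp Require Import all_boot all_order.
From mathcomp Require Import boolp classical_sets functions cardinality.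
From mathcomp Require Import topology finmap.
Local Open Scope classical_set_scope.

Import Order.TTheory.

Section CompleteLatticeTheory.
Local Open Scope order_scope.
Context {d : Order.disp_t} {L : completeLatticeType d}.

Lemma bigjoin_le (A B : set L) : A `<=` B -> bigjoin A <= bigjoin B.
Proof. by move=> AB; apply: bigjoin_least => x /AB; apply: bigjoin_ub. Qed.

Lemma bigjoin_seq_cons (x : L) (s : seq L) :
  bigjoin [set` x :: s] = x `|` bigjoin [set` s].
Proof.
apply/le_anti/andP; split.
  apply: bigjoin_least => y /=; rewrite inE => /orP[/eqP->|ys].
    exact: leUl.
  by apply: le_trans (leUr _ _); exact: bigjoin_ub.
rewrite leUx; apply/andP; split.
  by apply: bigjoin_ub => /=; rewrite inE eqxx.
by apply: bigjoin_le => y /= ys; rewrite inE ys orbT.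
Qed.

Lemma bigjoin_seq_nil : bigjoin [set` [::]] = \bot :> L.
Proof. by apply/le_anti; rewrite le0x andbT; apply: bigjoin_least. Qed.

Lemma compact_elt_bigjoin_seq (s : seq L) :
  [set` s] `<=` compact_elt -> compact_elt (bigjoin [set` s]).
Proof.
elim: s => [_|x s IHs xs_cpt]; first by rewrite bigjoin_seq_nil; exact: compact_elt0.
rewrite bigjoin_seq_cons; apply: compact_eltU.
  by apply: xs_cpt => /=; rewrite inE eqxx.
by apply: IHs => y /= ys; apply: xs_cpt; rewrite /= inE ys orbT.
Qed.

Lemma chain_bigjoin_finite {A X0 : set L} : A !=set0 ->
  total_on A (fun x y => x <= y) -> finite_set X0 -> X0 `<=` A ->
  exists2 a, A a & bigjoin X0 <= a.
Proof.
move=> [a0 Aa0] Atot /finite_seqP[s ->]; elim: s => [_|x s IHs xsA].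
  by exists a0 => //; rewrite bigjoin_seq_nil le0x.
have Ax : A x by apply: xsA => /=; rewrite inE eqxx.
have [|a Aa sa] := IHs; first by move=> y /= ys; apply: xsA; rewrite /= inE ys orbT.
rewrite bigjoin_seq_cons; have [xa|ax] := Atot _ _ Ax Aa.
  by exists a => //; rewrite leUx xa.
by exists x => //; rewrite leUx lexx (le_trans sa ax).
Qed.

Lemma maximal_avoiding {S : set L} {x : L} : S `<=` compact_elt ->
  (forall s, S s -> ~ s <= x) ->
  exists p, [/\ x <= p, forall s, S s -> ~ s <= p &
    forall y, ~ y <= p -> exists2 s, S s & s <= p `|` y].
Proof.
move=> Scpt Sx; pose Q : set L := [set y | x <= y /\ forall s, S s -> ~ s <= y].
have Qx : Q x by [].
pose R (u v : set_type Q) := \val u <= \val v.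
have [||A Atot|p pmax] := @ZL_preorder _ (SigSub (mem_set Qx)) R.
- by move=> u; exact: lexx.
- by move=> u v w; exact: le_trans.
- have [[a Aa]|A0] := pselect (A !=set0); last first.
    by exists (SigSub (mem_set Qx)) => a Aa; case: A0; exists a.
  pose B := \val @` A.
  have Qj : Q (bigjoin B).
    split=> [|s Ss sB].
      have [xa _] := set_mem (valP a).
      by apply: le_trans xa _; apply: bigjoin_ub; exists a.
    have [X0 [X0fin X0B sX0]] := Scpt _ Ss _ sB.
    have B0 : B !=set0 by exists (\val a), a.
    have Btot : total_on B (fun u v => u <= v).
      by move=> _ _ [u Au <-] [v Av <-]; exact: Atot.
    have [_ [b Ab <-] X0b] := chain_bigjoin_finite B0 Btot X0fin X0B.
    have [_ /(_ _ Ss)] := set_mem (valP b).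
    by apply; exact: le_trans X0b.
  by exists (SigSub (mem_set Qj)) => b Ab; apply: bigjoin_ub; exists b.
- have [xp Sp] := set_mem (valP p).
  exists (\val p); split=> // y yp; apply: contrapT => noS.
  have Qpy : Q (\val p `|` y).
    split=> [|s Ss spy]; first exact: (le_trans xp (leUl _ _)).
    by apply: noS; exists s.
  apply: yp; apply: le_trans (leUr y (\val p)) _.
  exact: (pmax (SigSub (mem_set Qpy)) (leUl _ _)).
Qed.

End CompleteLatticeTheory.

Section SpectrumTheory.
Local Open Scope order_scope.
Context {d : Order.disp_t} {L : multLatticeType d}.
Implicit Types (S : set L) (X : set (Spec L)).
Local Notation mul := Defs.mul.

Lemma open_D (x : L) : open (D x).
Proof. by exists x. Qed.

Lemma openP U : open U -> exists x : L, U = D x.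
Proof. by move=> [x _ <-]; exists x. Qed.

Lemma D_bigjoin (A : set L) : D (bigjoin A) = \bigcup_(x in A) D x.
Proof.
apply/seteqP; split=> p.
  apply: contra_notP => pA; apply: bigjoin_least => x Ax.
  by apply: contrapT => px; apply: pA; exists x.
by move=> [x Ax px] Ap; apply: px; apply: le_trans Ap; exact: bigjoin_ub.
Qed.

Lemma D_top : D \top = setT :> set (Spec L).
Proof.
apply/seteqP; split=> // p _; rewrite /D /V /= le1x => /eqP.
by have /set_mem[] := valP p.
Qed.

Lemma D_mul (x y : L) : D (mul x y) = D x `&` D y.
Proof.
rewrite -[RHS]classical_sets.setCU; congr (~` _); apply/seteqP; split=> p; rewrite /V /=.
  by have /set_mem[_] := valP p; apply.
by case=> /(le_trans _); apply; [exact: mul_lel|exact: mul_ler].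
Qed.

Lemma D_le {x y : L} : x <= y -> D x `<=` D y.
Proof. by move=> xy p px yp; apply: px; exact: le_trans yp. Qed.

Lemma open_V {c : L} : compact_elt c -> open (V c : set (SpecT L)).
Proof.
move=> cc; exists [set (V c : set (SpecT L))]; last by rewrite bigcup_set1.
by move=> _ ->; exists c.
Qed.

Lemma nbhs_V {p : SpecT L} {B : set (SpecT L)} : nbhs p B ->
  exists c, [/\ compact_elt c, V c p & V c `<=` B].
Proof.
rewrite nbhsE => -[U [[F Fbase <-] [W FW Wp]] UB].
have [c cc cW] := Fbase _ FW; exists c; split=> //; rewrite cW //.
by move=> q Wq; apply: UB; exists W.
Qed.

Lemma T_closureE X : T_closure X = P_ (S_ X).
Proof.
apply/seteqP; split=> p.
  move=> clXp c [cc Xc] pc.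
  have [q [Xq qc]] := clXp _ (open_nbhs_nbhs (conj (open_V cc) pc)).
  exact: Xc Xq qc.
move=> Pp B /nbhs_V[c [cc pc cB]]; apply: contrapT => XB0.
apply: (Pp c) => //; split=> // q Xq qc; apply: XB0.
by exists q; split=> //; exact: cB.
Qed.

Lemma S_T_closure X : S_ (T_closure X) = S_ X.
Proof.
rewrite T_closureE; apply/seteqP; split=> c [cc Xc]; split=> //.
  by move=> p Xp; apply: Xc => s [_ ]; apply.
by move=> p; apply.
Qed.

Lemma saturated_P S : saturated_set (P_ S).
Proof.
exists (@D d L @` S); first by move=> _ [s _ <-]; exact: open_D.
by rewrite bigcap_image.
Qed.

Lemma cover_compact_sub_D X x : algebraic L -> cover_compact X ->
  X `<=` D x -> exists c, [/\ compact_elt c, c <= x & X `<=` D c].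
Proof.
move=> Lalg Xcpt; have [A Acpt ->] := Lalg x; rewrite D_bigjoin => XA.
have [F FA XF] := Xcpt _ A (@D d L) (fun a _ => open_D a) XA.
exists (bigjoin [set` F]); split.
- by apply: compact_elt_bigjoin_seq => a /FA/set_mem; exact: Acpt.
- by apply: bigjoin_le => a /FA/set_mem.
- by rewrite D_bigjoin.
Qed.

Lemma saturated_m_system_S X : algebraic L -> cover_compact X ->
  saturated_m_system L (S_ X).
Proof.
move=> Lalg Xcpt; split; last first.
  by move=> x c [_ Xx] cc xc; split=> // p /Xx px cp; apply: px; exact: le_trans cp.
split=> [|c []//|x y [_ Xx] [_ Xy]].
  have [|c [cc _ Xc]] := cover_compact_sub_D X \top Lalg Xcpt.
    by rewrite D_top.
  by exists c.
have [|c [cc cxy Xc]] := cover_compact_sub_D X (mul x y) Lalg Xcpt.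
  by rewrite D_mul => p Xp; split; [exact: Xx|exact: Xy].
by exists c.
Qed.

Lemma T_closed_compact_saturated X : algebraic L -> compact_saturated L X ->
  T_closed X.
Proof.
move=> Lalg [Xcpt [F Fopen XF]] p; rewrite -/(T_closure X p) T_closureE => Pp.
rewrite XF => U FU; have [x Ux] := openP _ (Fopen _ FU).
have [|c [cc cx Xc]] := cover_compact_sub_D X x Lalg Xcpt.
  by rewrite -Ux XF => q; apply.
by rewrite Ux; apply: D_le cx _ _; apply: Pp.
Qed.

Section MDistributive.
Hypothesis Lmd : m_distributive L.

Lemma le_mul {x x' y y' : L} : x <= x' -> y <= y' -> mul x y <= mul x' y'.
Proof.
have [mDl mDr] := Lmd; move=> /join_r xx' /join_r yy'.
by rewrite -xx' -yy' mDl !mDr -joinA leUl.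
Qed.

Lemma mul_joinU_le (p a b : L) : mul (p `|` a) (p `|` b) <= p `|` mul a b.
Proof.
have [mDl mDr] := Lmd; rewrite mDl !mDr !leUx leUr andbT.
by rewrite !(le_trans _ (leUl p _)) ?mul_lel ?mul_ler.
Qed.

Lemma prime_avoiding {S} {x : L} : m_system S -> (forall s, S s -> ~ s <= x) ->
  exists2 p : Spec L, x <= \val p & P_ S p.
Proof.
move=> [[s0 Ss0] Scpt Smul] Sx.
have [p [xp Sp pmax]] := maximal_avoiding Scpt Sx.
suff pp : prime_elt p by exists (SigSub (mem_set pp)).
split=> [p1|a b abp]; first by apply: (Sp _ Ss0); rewrite p1 lex1.
apply: contrapT => /not_orP[/pmax[s Ss sa] /pmax[t St tb]].
have [z Sz zst] := Smul _ _ Ss St; apply: (Sp _ Sz).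
apply: le_trans zst _; apply: le_trans (le_mul sa tb) _.
by apply: le_trans (mul_joinU_le _ _ _) _; rewrite leUx lexx.
Qed.

Lemma P_sub_D {S} {x : L} : m_system S -> P_ S `<=` D x ->
  exists2 s, S s & s <= x.
Proof.
move=> Sm PSx; apply: contrapT => noS.
have [|p xp PSp] := prime_avoiding (x := x) Sm; last exact: PSx PSp xp.
by move=> s Ss sx; apply: noS; exists s.
Qed.

Lemma cover_compact_P S : m_system S -> cover_compact (P_ S).
Proof.
move=> Sm I A f fopen PSf.
pose B : set L := [set x | exists2 i, A i & f i = D x].
have [|s Ss sB] := P_sub_D (x := bigjoin B) Sm.
  move=> p /PSf[i Ai fip]; rewrite D_bigjoin.
  have [x fx] := openP _ (fopen _ Ai).
  by exists x; [exists i|rewrite -fx].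
have [_ Scpt _] := Sm; have [X0 [/finite_fsetP[F ->] FB sF]] := Scpt _ Ss _ sB.
have /choice[g gP] (x : F) : exists i, A i /\ f i = D (\val x).
  by have [i Ai fi] := FB _ (valP x); exists i.
have /finite_fsetP[E gE] : finite_set (g @` setT).
  exact/finite_image/finite_finset.
exists E => [i iE|p PSp].
  have : [set` E] i by [].
  by rewrite -gE => -[x _ <-]; apply: mem_set; have [] := gP x.
have := D_le sF _ (PSp _ Ss); rewrite D_bigjoin => -[x Fx px].
exists (g [` Fx]%fset); last by have [_ ->] := gP [` Fx]%fset.
by rewrite -gE; exists [` Fx]%fset.
Qed.

Lemma S_P_K S : saturated_m_system L S -> S_ (P_ S) = S.
Proof.
move=> [Sm Ssat]; have [_ Scpt _] := Sm; apply/seteqP; split=> c.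
  by move=> [cc /(P_sub_D Sm)[s Ss sc]]; exact: Ssat sc.
by move=> Sc; split=> [|p]; [exact: Scpt|apply].
Qed.

End MDistributive.
End SpectrumTheory.

Theorem corollary6p5 (d : Order.disp_t) (L : multLatticeType d)
    (L_algebraic : algebraic L) (L_m_distributive : m_distributive L) :
  (forall X : set (Spec L),
      saturated_m_system L (S_ X) <-> cover_compact (T_closure X)) /\
  ((forall X : set (Spec L), compact_saturated L X -> T_closed X) /\
   [/\ set_bij (compact_saturated L) (saturated_m_system L) S_,
       set_bij (saturated_m_system L) (compact_saturated L) P_,
       (forall X, compact_saturated L X -> P_ (S_ X) = X) /\
       (forall S, saturated_m_system L S -> S_ (P_ S) = S),
       (forall X Y, compact_saturated L X -> compact_saturated L Y ->
          X `<=` Y -> S_ Y `<=` S_ X) &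
       (forall S T, saturated_m_system L S -> saturated_m_system L T ->
          S `<=` T -> P_ T `<=` P_ S)]).
Proof.
have S_in (X : set (Spec L)) : compact_saturated L X -> saturated_m_system L (S_ X).
  by move=> [Xcpt _]; exact: saturated_m_system_S.
have P_in (S : set L) : saturated_m_system L S -> compact_saturated L (P_ S).
  by move=> [Sm _]; split; [exact: cover_compact_P|exact: saturated_P].
have SK (X : set (Spec L)) : compact_saturated L X -> P_ (S_ X) = X.
  move=> Xcs; rewrite -T_closureE.
  apply/seteqP; split; first exact: T_closed_compact_saturated.
  exact: (@subset_closure (SpecT L)).
have PK (S : set L) : saturated_m_system L S -> S_ (P_ S) = S.
  exact: S_P_K.
split=> [X|].
  split=> [[Sm _]|]; first by rewrite T_closureE; exact: cover_compact_P.
  by rewrite -(S_T_closure X); exact: saturated_m_system_S.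
split=> [X|]; first exact: T_closed_compact_saturated.
split=> //.
- split=> [X|X Y /set_mem hX /set_mem hY eXY|S hS]; first exact: S_in.
    by rewrite -(SK X) // eXY SK.
  by exists (P_ S); [exact: P_in|exact: PK].
- split=> [S|S T /set_mem hS /set_mem hT eST|X hX]; first exact: P_in.
    by rewrite -(PK S) // eST PK.
  by exists (S_ X); [exact: S_in|exact: SK].
- by move=> X Y _ _ XY c [cc Yc]; split=> // p /XY; exact: Yc.
- by move=> S T _ _ ST p Tp s /ST; exact: Tp.
Qed.
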